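(* Let $\mathcal{A}$ be a parity automaton with costs over an alphabet $\Sigma_I\times\Sigma_O$ with $n$ states and $k$ colors (i.e., $|\Omega(Q)|=k$), let $L=L(\mathcal{A})$, and let $f$ be the constant delay function with $f(0)=2^{2n^4k^2+1}$. Then the following are equivalent: (1) Player $I$ wins $\Gamma_f(L(\mathcal{A}))$; (2) Player $I$ wins $\Gamma_{f'}(L(\mathcal{A}))$ for every delay function $f'$.
   Context: A parity automaton with costs is a tuple $\mathcal{A}=(Q,\Sigma,q_I,\delta,\Omega,\mathrm{Cst})$ with a finite set $Q$ of states, a finite alphabet $\Sigma$, an initial state $q_I$, a deterministic complete transition function $\delta\colon Q\times\Sigma\to Q$, a coloring $\Omega\colon Q\to\mathbb{N}$, and a cost function $\mathrm{Cst}$ assigning to every transition $(q,a,\delta(q,a))$ either $\epsilon$ or $\mathtt{i}$ (increment-transition). Throughout, $\Omega(Q)$ contains both an even and an odd color. The run on $a_0a_1\cdots$ is $(q_0,a_0,q_1)(q_1,a_1,q_2)\cdots$ with $q_0=q_I$, $q_{j+1}=\delta(q_j,a_j)$; the cost of a finite run is its number of increment-transitions. For odd $c$, $\mathrm{Ans}(c)=\{c'\in\Omega(Q)\mid c'>c,\ c'\text{ even}\}$. For an infinite run $\rho$ and $n$, $\mathrm{Cor}(\rho,n)=0$ if $\Omega(q_n)$ is even, and otherwise it is the minimal cost of $(q_n,a_n,q_{n+1})\cdots(q_{n'-1},a_{n'-1},q_{n'})$ over $n'>n$ with $\Omega(q_{n'})\in\mathrm{Ans}(\Omega(q_n))$ ($\min\emptyset=\infty$).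 The run is accepting if $\limsup_n\mathrm{Cor}(\rho,n)<\infty$; $L(\mathcal{A})$ is the set of infinite words whose run is accepting. A delay function is a map $f\colon\mathbb{N}\to\mathbb{N}\setminus\{0\}$; it is constant if $f(i)=1$ for every $i>0$. For $L\subseteq(\Sigma_I\times\Sigma_O)^\omega$, the delay game $\Gamma_f(L)$ is played in rounds $i=0,1,2,\ldots$: in round $i$, Player $I$ picks $u_i\in\Sigma_I^{f(i)}$, then Player $O$ picks $v_i\in\Sigma_O$. Player $O$ wins the play if the outcome, i.e., the word over $\Sigma_I\times\Sigma_O$ pairing $u_0u_1u_2\cdots$ and $v_0v_1v_2\cdots$ letterwise, is in $L$; otherwise Player $I$ wins. A strategy for Player $I$ is a map $\tau_I\colon\Sigma_O^*\to\Sigma_I^*$ with $|\tau_I(w)|=f(|w|)$; a strategy for Player $O$ is a map $\tau_O\colon\Sigma_I^*\to\Sigma_O$. A play is consistent with $\tau_I$ if $u_i=\tau_I(v_0\cdots v_{i-1})$ for all $i$, and with $\tau_O$ if $v_i=\tau_O(u_0\cdots u_i)$ for all $i$. A strategy is winning if every consistent play is won by its owner; a player wins the game if she has a winning strategy. *)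

(* Defs.v *)
From mathcomp Require Import all_boot.
Set Implicit Arguments. Unset Strict Implicit. Unset Printing Implicit Defensive.

(* Parity automaton with costs over alphabet Sigma with state space Q.
   Cst q a = true  iff the transition (q, a, delta q a) is an increment-transition. *)
Record PAC (Q Sigma : finType) := mkPAC {
  qI : Q;
  delta : Q -> Sigma -> Q;
  Omega : Q -> nat;
  Cst : Q -> Sigma -> bool
}.

Section Automata.
Variables (Q Sigma : finType) (A : PAC Q Sigma).

Definition colors : seq nat := undup [seq Omega A q | q <- enum Q].
Definition num_colors : nat := size colors.

(* standing assumption: Omega(Q) contains an even and an odd color *)
Definition has_even_and_odd_color : Prop :=
  (exists q, ~~ odd (Omega A q)) /\ (exists q, odd (Omega A q)).

(* Ans(c) for odd c *)
Definition Ans (c c' : nat) : bool := [&& c' \in colors, c < c' & ~~ odd c'].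

Fixpoint run_state (w : nat -> Sigma) (j : nat) : Q :=
  match j with
  | 0 => qI A
  | j'.+1 => delta A (run_state w j') (w j')
  end.

Definition seg_cost (w : nat -> Sigma) (n n' : nat) : nat :=
  \sum_(n <= j < n') Cst A (run_state w j) (w j).

(* Cor(rho, n) <= B, for B a natural number (Cor takes values in nat ∪ {∞}) *)
Definition Cor_le (w : nat -> Sigma) (n B : nat) : Prop :=
  ~~ odd (Omega A (run_state w n)) \/
  exists n', [/\ n < n', Ans (Omega A (run_state w n)) (Omega A (run_state w n'))
               & seg_cost w n n' <= B].

(* limsup_n Cor(rho, n) < ∞ *)
Definition accepting (w : nat -> Sigma) : Prop :=
  exists B N, forall n, N <= n -> Cor_le w n B.

Definition lang : (nat -> Sigma) -> Prop := accepting.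
End Automata.

Definition delay_function (f : nat -> nat) : Prop := forall i, 0 < f i.
Definition constant_delay (f : nat -> nat) : Prop :=
  delay_function f /\ forall i, 0 < i -> f i = 1.

Definition block_start (f : nat -> nat) (i : nat) : nat := \sum_(l < i) f l.

Section Games.
Variables (SI SO : finType).

(* a play is given by the input word x = u_0 u_1 ... (block u_i occupying
   positions [F i, F i + f i)) and the output word v = v_0 v_1 ... *)
Definition block (f : nat -> nat) (x : nat -> SI) (i : nat) : seq SI :=
  [seq x j | j <- iota (block_start f i) (f i)].

Definition prefix_out (v : nat -> SO) (i : nat) : seq SO := [seq v l | l <- iota 0 i].

Definition strategyI_valid (f : nat -> nat) (tauI : seq SO -> seq SI) : Prop :=
  forall w, size (tauI w) = f (size w).

Definition consistentI (f : nat -> nat) (tauI : seq SO -> seq SI)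
  (x : nat -> SI) (v : nat -> SO) : Prop :=
  forall i, block f x i = tauI (prefix_out v i).

Definition consistentO (f : nat -> nat) (tauO : seq SI -> SO)
  (x : nat -> SI) (v : nat -> SO) : Prop :=
  forall i, v i = tauO [seq x j | j <- iota 0 (block_start f i.+1)].

Definition outcome (x : nat -> SI) (v : nat -> SO) : nat -> (SI * SO)%type :=
  fun j => (x j, v j).

Definition PlayerI_wins (f : nat -> nat) (L : (nat -> (SI * SO)%type) -> Prop) : Prop :=
  exists tauI, strategyI_valid f tauI /\
    forall x v, consistentI f tauI x v -> ~ L (outcome x v).

Definition PlayerO_wins (f : nat -> nat) (L : (nat -> (SI * SO)%type) -> Prop) : Prop :=
  exists tauO, forall x v, consistentO f tauO x v -> L (outcome x v).
End Games.

(* Main.v *)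
Require Import Defs.
From mathcomp Require Import all_boot.
From mathcomp Require Import zify.

(* A strategy of Player I for the short lookahead [2 * d] is transported
   directly to any delay function, so determinacy is not needed. A segment of a
   run is abstracted to its end state, its largest request left open, its
   largest even color and whether its cost is positive; the profile of an input
   word is the set of abstractions it allows from each state. There are at most
   [d] profiles, they form a right congruence, and so every input block of
   length [d] has arbitrarily long counterparts of the same profile. Player I
   plays such long counterparts of the blocks given by her short strategy, and
   answers her opponent's long blocks in the short game by blocks of length [d]
   with the same abstraction. A block of positive cost costs at least 1 in the
   long play and its counterpart at most [d] in the short one, so acceptance of
   the long play would imply acceptance of the short one. *)
Set Implicit Arguments. Unset Strict Implicit. Unset Printing Implicit Defensive.

(** * Slices of infinite words, chains of prefixes, block boundaries *)

Definition slice (T : Type) (w : nat -> T) (s m : nat) : seq T :=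
  [seq w l | l <- iota s m].

Lemma slice_ext (T : Type) (w w' : nat -> T) s m :
  (forall t, s <= t < s + m -> w t = w' t) -> slice w s m = slice w' s m.
Proof.
move=> e; apply/eq_in_map => t; rewrite mem_iota; exact: e.
Qed.

Lemma drop_take_slice (T : Type) (x0 : T) (u : seq T) s e :
  s <= e <= size u -> drop s (take e u) = slice (nth x0 u) s (e - s).
Proof.
move=> /andP[le1 le2]; rewrite /slice map_nth_iota; last by lia.
by rewrite take_drop subnK.
Qed.

Lemma prefix_chain_nth (T : Type) (x0 : T) (S : nat -> seq T) :
  (forall j, exists u, S j.+1 = S j ++ u) ->
  forall i j t, i <= j -> t < size (S i) ->
  nth x0 (S j) t = nth x0 (S i) t.
Proof.
move=> chain i j t /subnKC <-.
suff H k : t < size (S i) ->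
    t < size (S (i + k)) /\ nth x0 (S (i + k)) t = nth x0 (S i) t.
  by move=> /(H (j - i)) [].
move=> lt; elim: k => [|k [lt' IH]]; first by rewrite addn0.
have [u e] := chain (i + k).
by rewrite addnS e nth_cat size_cat lt' IH; split=> //; lia.
Qed.

Lemma interval_index (p : nat -> nat) t :
  p 0 = 0 -> (forall j, p j < p j.+1) -> exists j, p j <= t < p j.+1.
Proof.
move=> p0 lt; elim: t => [|t [j /andP[le1 le2]]].
  by exists 0; rewrite p0; have := lt 0; rewrite p0.
have [lt2|ge2] := ltnP t.+1 (p j.+1); first by exists j; lia.
by exists j.+1; have := lt j.+1; lia.
Qed.

Lemma homo_geq_id (p : nat -> nat) j : (forall i, p i < p i.+1) -> j <= p j.
Proof. by move=> lt; elim: j => // j IH; have := lt j; lia. Qed.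

(** * Finite abstraction of run segments *)

Section Observation.
Variables (Q Sigma : finType) (A : PAC Q Sigma).
Implicit Types (w : nat -> Sigma) (q : Q) (o : option Q).

(** The shift by one puts [None] below every color and turns [<=] against a color into a strict
    comparison of colors. *)
Definition weight o : nat := if o is Some q then (Omega A q).+1 else 0.

(* (largest request left open, largest even color, whether the cost is
   positive); colors are represented by states carrying them. *)
Definition info : finType := (option Q * option Q * bool)%type.

(** The color inspected is that of the state being left, so the final state of a segment counts for
    the next segment. *)
Definition observe_step (z : Q * info) (a : Sigma) : Q * info :=
  let: (p, (o, e, b)) := z in
  (delta A p a,
   (if weight o <= Omega A p then
      if odd (Omega A p) then Some p else None
    else o,
    if ~~ odd (Omega A p) && (weight e <= Omega A p) then Some p else e,
    b || Cst A p a)).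

Definition observe q (u : seq Sigma) : Q * info :=
  foldl observe_step (q, (None, None, false)) u.

(** Each maximum has a bound and a witness. For open requests the transfer uses the bound in the
    short run and the witness in the long one; for even colors it is the other way round. *)
Record observation w (s t : nat) (i : info) : Prop := Observation {
  open_bound : forall n, s <= n < t -> odd (Omega A (run_state A w n)) ->
    Omega A (run_state A w n) < weight i.1.1 \/
    exists2 n', n < n' < t &
      Ans A (Omega A (run_state A w n)) (Omega A (run_state A w n'));
  open_witness : 0 < weight i.1.1 -> exists n,
    [/\ s <= n < t, odd (Omega A (run_state A w n)),
        weight i.1.1 = (Omega A (run_state A w n)).+1 &
        forall m, n < m < t -> ~~ odd (Omega A (run_state A w m)) ->
          Omega A (run_state A w m) < weight i.1.1];
  even_bound : forall m, s <= m < t -> ~~ odd (Omega A (run_state A w m)) ->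
    Omega A (run_state A w m) < weight i.1.2;
  even_witness : 0 < weight i.1.2 -> exists m,
    [/\ s <= m < t, ~~ odd (Omega A (run_state A w m)) &
        weight i.1.2 = (Omega A (run_state A w m)).+1];
  cost_positive : i.2 = (0 < seg_cost A w s t) }.

Lemma mem_colors q : Omega A q \in colors A.
Proof. by rewrite mem_undup map_f // mem_enum. Qed.

Lemma seg_costD w r s t :
  r <= s -> s <= t -> seg_cost A w r t = seg_cost A w r s + seg_cost A w s t.
Proof. by move=> le1 le2; rewrite /seg_cost (big_cat_nat le1 le2). Qed.

Lemma seg_cost_subset w r s s' t' :
  s <= r -> s' <= t' -> seg_cost A w r s' <= seg_cost A w s t'.
Proof.
move=> le1 le2; have [le|/ltnW le] := leqP r s'; last first.
  by rewrite /seg_cost big_geq.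
by rewrite (@seg_costD _ s r t') ?(@seg_costD _ r s' t') //; lia.
Qed.

Lemma seg_cost_length w s t : seg_cost A w s t <= t - s.
Proof.
rewrite /seg_cost -[leqRHS]muln1 -[leqRHS]sum_nat_const_nat.
by apply: leq_sum => i _; case: (Cst _ _ _).
Qed.

Lemma observe_run w s m :
  (observe (run_state A w s) (slice w s m)).1 = run_state A w (s + m) /\
  observation w s (s + m) (observe (run_state A w s) (slice w s m)).2.
Proof.
elim: m => [|m [IHq IHi]].
  rewrite addn0; split=> //; split=> //=; try by move=> n; lia.
  by rewrite /seg_cost big_geq.
rewrite /slice -addn1 iotaD map_cat /observe foldl_cat /= -/(observe _ _).
rewrite addn1 addnS.
case: (observe _ _) IHq IHi => p [[o e] b] /= ep [] /= ob ow eb ew cp.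
rewrite {p}ep; split=> //; set P := run_state A w (s + m) in ob ow eb ew cp *.
split=> /=.
- move=> n; rewrite ltnS => /andP[le1]; rewrite leq_eqVlt => /orP[/eqP->|lt2] on.
    by left; rewrite -/P in on *; case: (leqP (weight o)) => // _; rewrite on.
  have [|lt|[n' /andP[? ?] an]] := ob n _ on; first by lia.
    case: (leqP (weight o)) => leo; last by left.
    case: ifP => ev /=; first by left=> /=; lia.
    right; exists (s + m); first by lia.
    by rewrite /Ans mem_colors ev /= andbT -/P; lia.
  by right; exists n' => //; lia.
- case: (leqP (weight o)) => leo.
    case: ifP => //= on _; exists (s + m); rewrite -/P; split=> //; first lia.
    by move=> n; lia.
  move=> /ow [n [ltn on eo H]]; exists n; split=> //; first lia.
  move=> k /andP[k1]; rewrite ltnS leq_eqVlt => /orP[/eqP->|k2] ek //.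
  by apply: (H k _ ek); rewrite k1.
- move=> k; rewrite ltnS => /andP[le1]; rewrite leq_eqVlt => /orP[/eqP->|lt2] ek.
    by rewrite -/P in ek *; rewrite ek /=; case: (leqP (weight e)) => //=.
  have := eb k; rewrite le1 lt2 => /(_ isT ek) lt.
  by case: ifP => //= /andP[_ ?]; lia.
- case: ifP => [/andP[ev _] _|_ /ew [k [? ? ?]]].
    by exists (s + m); rewrite -/P; split=> //; lia.
  by exists k; split=> //; lia.
- rewrite (@seg_costD _ s (s + m)) ?leq_addr // /seg_cost big_nat1 -/P.
  by rewrite cp addn_gt0; case: Cst.
Qed.

(* An accepting run stays accepting when it is recut into blocks of bounded
   length with the same observations: a request survives the end of its block
   only if it is dominated by the open request of the corresponding block, and
   the blocks up to its answer cost at most [d] each, but only where the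
   corresponding block has positive cost. *)
Lemma accepting_transfer w w' d (p' : nat -> nat) :
  0 < d -> p' 0 = 0 -> (forall j, p' j < p' j.+1) ->
  (forall j, observe (run_state A w (j * d)) (slice w (j * d) d) =
             observe (run_state A w' (p' j)) (slice w' (p' j) (p' j.+1 - p' j))) ->
  accepting A w' -> accepting A w.
Proof.
move=> d_gt0 p'0 p'lt eobs [B [N acc]].
pose i j := (observe (run_state A w (j * d)) (slice w (j * d) d)).2.
have obs j : observation w (j * d) (j.+1 * d) (i j).
  by rewrite mulSn addnC; case: (observe_run w (j * d) d).
have obs' j : observation w' (p' j) (p' j.+1) (i j).
  rewrite /i eobs; have := (observe_run w' (p' j) (p' j.+1 - p' j)).2.
  by rewrite subnKC // ltnW.
(* A block of [w] costs at most [d], and nothing unless its counterpart in [w'] costs at least 1. *)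
have cost_blocks a b : a <= b ->
    seg_cost A w (a * d) (b * d) <= d * seg_cost A w' (p' a) (p' b).
  move=> /subnKC <-; elim: (b - a) => {b} [|k IH].
    by rewrite addn0 /seg_cost big_geq.
  have p'le : p' a <= p' (a + k).
    by elim: (k) => [|l]; rewrite ?addn0 // addnS; have := p'lt (a + l); lia.
  rewrite addnS (@seg_costD w _ ((a + k) * d)) ?leq_mul2r ?leq_addr ?leqnSn ?orbT //.
  rewrite (@seg_costD w' _ (p' (a + k))) ?(ltnW (p'lt _)) //.
  rewrite mulnDr leq_add //.
  have := cost_positive (obs (a + k)); rewrite (cost_positive (obs' _)).
  have := seg_cost_length w ((a + k) * d) ((a + k).+1 * d).
  rewrite mulSn addnK.
  case: (seg_cost A w' _ _) => [|c]; first by case: (seg_cost A w _ _).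
  by move=> ? _; rewrite mulnS; lia.
(* [d * B] pays for the whole blocks before the answer, [2 * d] for the partial blocks at both ends.
   From [N * d] on, the block index [j] is at least [N], hence so is [p' j]. *)
exists (d * B + 2 * d), (N * d) => n leNn.
have [ev|] := boolP (~~ odd (Omega A (run_state A w n))); first by left.
rewrite negbK => on; right.
pose j := n %/ d.
have jn : j * d <= n < j.+1 * d by rewrite leq_divM ltn_ceil.
have leNj : N <= j by rewrite leq_divRL.
have [lt_open|[n' ltn' an]] := open_bound (obs j) jn on; last first.
  exists n'; split=> //; first by lia.
  by apply: leq_trans (seg_cost_length _ _ _) _; move: jn; rewrite mulSn; lia.
(* Block [j] of the run on [w'] has an open request [n'] of color at least that of [n]. Its answer
   [m'] lies in a later block [l], whose counterpart in [w] has an even color at least as large. *)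
have [|n' [n'in on' en' open']] := open_witness (obs' j); first by lia.
have := acc n' (leq_trans leNj _).
move=> /(_ _) [].
  by apply: leq_trans (homo_geq_id j p'lt) _; lia.
  by rewrite on'.
move=> [m' [ltm' am' costm']].
have [_ lt_am' ev_m'] := and3P am'.
have m'ge : p' j.+1 <= m'.
  rewrite leqNgt; apply/negP => m'lt.
  by have := open' m'; rewrite ltm' m'lt => /(_ isT ev_m'); lia.
have [l m'in] := interval_index m' p'0 p'lt.
have p'homo a b : a <= b -> p' a <= p' b.
  by move=> /subnKC <-; elim: (b - a) => [|c]; rewrite ?addn0 // addnS;
     have := p'lt (a + c); lia.
have ltjl : j < l.
  by rewrite ltnNge; apply/negP => lelj; have := p'homo l.+1 j.+1 lelj; lia.
have lt_even := even_bound (obs' l) m'in ev_m'.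
have [|m [min ev_m em]] := even_witness (obs l); first by lia.
have lejl : j.+1 * d <= l * d by rewrite leq_mul2r ltjl orbT.
exists m; split; first lia.
  by rewrite /Ans mem_colors ev_m andbT /=; lia.
rewrite (@seg_costD _ n (j.+1 * d)); [|lia|lia].
rewrite (@seg_costD w (j.+1 * d) (l * d)); [|lia|lia].
have c1 := seg_cost_length w n (j.+1 * d).
have c2 := seg_cost_length w (l * d) m.
have c3 := cost_blocks _ _ ltjl.
have c4 : seg_cost A w' (p' j.+1) (p' l) <= B.
  by apply: leq_trans costm'; apply: seg_cost_subset; lia.
have c5 : d * seg_cost A w' (p' j.+1) (p' l) <= d * B by rewrite leq_mul2l c4 orbT.
have c6 : j.+1 * d - n <= d by move: jn; rewrite mulSn; lia.
have c7 : m - l * d <= d by move: min; rewrite mulSn; lia.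
have := leq_add (leq_trans c1 c6) (leq_add (leq_trans c3 c5) (leq_trans c2 c7)).
by move=> /leq_trans; apply; rewrite mul2n -addnn addnCA.
Qed.

End Observation.

(** * Profiles of input words and pumping *)

Section Profiles.
Variables (SI SO Q : finType) (A : PAC Q (SI * SO)%type).
Implicit Types (x : seq SI) (y : seq SO).

Definition profile x : {set Q * (Q * info Q)} :=
  [set z | [exists y : (size x).-tuple SO, observe A z.1 (zip x y) == z.2]].

Lemma profileP x z :
  reflect (exists2 y, size y = size x & observe A z.1 (zip x y) = z.2)
          (z \in profile x).
Proof.
rewrite inE; apply: (iffP existsP) => [[y /eqP e]|[y /eqP s e]].
  by exists y; rewrite ?size_tuple.
by exists (Tuple s); rewrite /= e.
Qed.

(** [observe] is a fold, so the part of an output that lies above [x1] can be exchanged for one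
    above [x2] with the same observation. *)
Lemma profile_cat x1 x2 x3 :
  profile x1 = profile x2 -> profile (x1 ++ x3) = profile (x2 ++ x3).
Proof.
suff H x x' : profile x = profile x' -> profile (x ++ x3) \subset profile (x' ++ x3).
  by move=> e; apply/eqP; rewrite eqEsubset !H.
move=> e; apply/subsetP => z /profileP [y sy obs]; apply/profileP.
rewrite size_cat in sy.
have sy1 : size (take (size x) y) = size x by rewrite size_takel // sy leq_addr.
have : (z.1, observe A z.1 (zip x (take (size x) y))) \in profile x'.
  by rewrite -e; apply/profileP; exists (take (size x) y).
move=> /profileP [y' sy' /= obs'].
exists (y' ++ drop (size x) y).
  by rewrite !size_cat size_drop sy sy' addKn.
rewrite zip_cat // /observe foldl_cat -!/(observe _ _ _) obs' -obs.
by rewrite -{3}(cat_take_drop (size x) y) zip_cat // /observe foldl_cat.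
Qed.

(** The implication sits under the existential so that [xchoose] yields a total function. *)
Lemma profile_match x x' q y' : exists y,
  (profile x == profile x') && (size y' == size x') ==>
  (size y == size x) && (observe A q (zip x y) == observe A q (zip x' y')).
Proof.
have [/andP[/eqP e /eqP s]|_] /= := boolP (_ && _); last by exists [::].
have : (q, observe A q (zip x' y')) \in profile x.
  by rewrite e; apply/profileP; exists y'.
by move=> /profileP [y sy obs]; exists y; rewrite sy /= in obs *; rewrite obs !eqxx.
Qed.

(** Pigeonhole: two of the [(size x).+1] prefixes have the same profile, and the piece between them
    can be repeated. *)
Lemma profile_pump_step x :
  #|{set Q * (Q * info Q)}| <= size x ->
  exists2 x', size x < size x' & profile x' = profile x.
Proof.
move=> card; pose g (i : 'I_(size x).+1) := profile (take i x).
have /injectivePn [i [j nij eg]] : ~~ injectiveb g.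
  by apply/negP => /injectiveP /leq_card; rewrite card_ord leqNgt ltnS card.
wlog ltij : i j nij eg / i < j => [H|].
  case: (ltngtP i j) => [lt|lt|/val_inj e].
  - exact: (H i j).
  - by apply: (H j i) => //; rewrite eq_sym.
  - by rewrite e eqxx in nij.
have := ltn_ord i; have := ltn_ord j => ltj lti.
exists (take j x ++ drop i x).
  by rewrite size_cat size_takel ?size_drop; lia.
by rewrite -(profile_cat _ eg) cat_take_drop.
Qed.

Lemma profile_pump x m : exists x',
  (#|{set Q * (Q * info Q)}| <= size x) ==>
  (m <= size x') && (profile x' == profile x).
Proof.
have [card|_] /= := boolP (_ <= size x); last by exists [::].
suff [x' [_ le /eqP e]] : exists x',
    [/\ size x <= size x', m <= size x' & profile x' = profile x].
  by exists x'; rewrite le.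
elim: m => [|m [x' [le1 le2 e]]]; first by exists x.
have [x'' lt e'] := profile_pump_step (leq_trans card le1).
by exists x''; rewrite e' e; split=> //; lia.
Qed.

Lemma card_profile :
  has_even_and_odd_color A ->
  #|{set Q * (Q * info Q)}| <= 2 ^ (2 * #|Q| ^ 4 * num_colors A ^ 2).
Proof.
move=> [[q1 ev] [q2 od]].
have k2 : 1 < num_colors A.
  have ne : Omega A q1 != Omega A q2 by apply: contraNneq ev => ->.
  rewrite -[2]/(size [:: Omega A q1; Omega A q2]); apply: uniq_leq_size.
    by rewrite /= inE ne.
  by move=> c; rewrite !inE => /orP[] /eqP->; rewrite mem_colors.
have n1 : 0 < #|Q| by apply/card_gt0P; exists q1.
have -> (T : finType) : #|{set T}| = 2 ^ #|T|.
  by have := card_powerset [set: T]; rewrite powersetT !cardsT.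
rewrite leq_exp2l // !card_prod !card_option card_bool.
set n := #|Q| in n1 *; set k := num_colors A in k2 *.
(* The exponent to bound is [2 * n ^ 2 * n.+1 ^ 2]; having two colors absorbs each factor [n.+1]
   into [n * k]. *)
have le : n.+1 <= n * k by apply: leq_trans (leq_mul (leqnn n) k2); lia.
have := leq_mul (leq_mul (leqnn (n * n * 2)) le) le.
by rewrite !expnS !expn0; nia.
Qed.

End Profiles.

(** * Strategies of Player I as causal functions on infinite words *)

Section CausalStrategies.
Variables (SI SO : finType) (f : nat -> nat).

Lemma block_startS i : block_start f i.+1 = block_start f i + f i.
Proof. by rewrite /block_start big_ord_recr. Qed.

Definition causal (X : (nat -> SO) -> nat -> SI) : Prop :=
  forall i v v', (forall l, l < i -> v l = v' l) ->
  forall t, t < block_start f i.+1 -> X v t = X v' t.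

Hypothesis fpos : delay_function f.

Lemma block_startP t : exists i, block_start f i <= t < block_start f i.+1.
Proof.
apply: interval_index; first by rewrite /block_start big_ord0.
by move=> j; rewrite block_startS; have := fpos j; lia.
Qed.

Lemma block_start_homo i j : i <= j -> block_start f i <= block_start f j.
Proof.
move=> /subnKC <-; elim: (j - i) => [|k]; rewrite ?addn0 // addnS block_startS.
lia.
Qed.

Lemma prefix_out_ext (v v' : nat -> SO) i :
  (forall l, l < i -> v l = v' l) -> prefix_out v i = prefix_out v' i.
Proof. by move=> e; apply: slice_ext => t; rewrite add0n => /e. Qed.

Lemma strategyI_causal (s0 : SI) (tau : seq SO -> seq SI) :
  strategyI_valid f tau ->
  exists2 X, causal X & forall v, consistentI f tau (X v) v.
Proof.
move=> val; pose idx t := xchoose (block_startP t).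
have idxP t : block_start f (idx t) <= t < block_start f (idx t).+1.
  exact: xchooseP (block_startP t).
exists (fun v t => nth s0 (tau (prefix_out v (idx t))) (t - block_start f (idx t))).
  move=> i v v' e t lt; congr (nth _ (tau _) _); apply: prefix_out_ext => l ltl.
  apply: e; apply: leq_trans ltl _; rewrite leqNgt; apply/negP => lti.
  by have := block_start_homo lti; have := idxP t; lia.
move=> v i; apply: (@eq_from_nth _ s0).
  by rewrite /block size_map size_iota val size_map size_iota.
rewrite size_map size_iota => l ltl.
rewrite (nth_map 0) ?size_iota // nth_iota //.
suff -> : idx (block_start f i + l) = i by rewrite addKn.
have := idxP (block_start f i + l); set j := idx _ => /andP[le1 le2].
have := block_startS i.
case: (ltngtP j i) => // [/block_start_homo|/block_start_homo]; lia.
Qed.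

(** Padding the finite history with [o0] is harmless, since causality hides the padded letters. *)
Lemma causal_PlayerI_wins (o0 : SO) (X : (nat -> SO) -> nat -> SI) L :
  causal X -> (forall x v, x =1 X v -> ~ L (outcome x v)) -> PlayerI_wins f L.
Proof.
move=> cX win.
exists (fun u => slice (X (nth o0 u)) (block_start f (size u)) (f (size u))).
split=> [u|x v cons]; first by rewrite size_map size_iota.
apply: win => t; have [i ti] := block_startP t.
have := cons i; rewrite /block size_map size_iota => /eq_in_map -> //; last first.
  by rewrite mem_iota -block_startS.
apply: (cX i) => [l lt|]; last by case/andP: ti.
by rewrite (nth_map 0) ?size_iota // nth_iota.
Qed.

End CausalStrategies.

(** * Simulation of the short game inside the long one *)

Section Simulation.
Variables (SI SO Q : finType) (A : PAC Q (SI * SO)%type) (s0 : SI) (o0 : SO).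
Variables (X : (nat -> SO) -> nat -> SI) (d : nat) (bound : nat -> nat).
Hypothesis d_gt0 : 0 < d.
Hypothesis card_le_d : #|{set Q * (Q * info Q)}| <= d.
Hypothesis X_causal : forall i y y', (forall l, l < i -> y l = y' l) ->
  forall t, t < 2 * d + i -> X y t = X y' t.
Hypothesis bound_homo : {homo bound : i j / i <= j}.

Definition pump x m : seq SI := xchoose (profile_pump A x m).

Lemma pumpP x m : size x = d ->
  m <= size (pump x m) /\ profile A (pump x m) = profile A x.
Proof.
move=> sx; have := xchooseP (profile_pump A x m).
by rewrite -/(pump x m) sx card_le_d => /andP[? /eqP].
Qed.

Definition matching x x' q y' : seq SO := xchoose (profile_match A x x' q y').

Lemma matchingP x x' q y' : profile A x = profile A x' -> size y' = size x' ->
  size (matching x x' q y') = size x /\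
  observe A q (zip x (matching x x' q y')) = observe A q (zip x' y').
Proof.
move=> e s; have := xchooseP (profile_match A x x' q y').
rewrite -/(matching x x' q y') e s !eqxx.
by case/andP=> /eqP ? /eqP.
Qed.

Local Opaque pump matching observe profile.

(* The state of the simulation when Player O has answered the first [j] blocks
   of the long game: her simulated answers in the game of lookahead [d], Player
   I's letters so far, consisting of [j + 2] blocks, the boundaries of block
   [j] therein, and the state reached at its beginning. *)
Record sim := Sim {
  sim_out : seq SO;
  sim_in : seq SI;
  sim_start : nat;
  sim_end : nat;
  sim_state : Q }.

Definition shadow (ys : seq SO) (i : nat) : seq SI :=
  slice (X (nth o0 ys)) (i * d) d.

(** The new block is longer than [bound (size C)], so every letter that Player I owes before all of
    [C] is answered is present; [bound] will be [block_start f']. *)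
Definition extend i ys C := C ++ pump (shadow ys i) (bound (size C)).+1.

Definition sim0 : sim :=
  let C := extend 0 [::] [::] in Sim [::] (extend 1 [::] C) 0 (size C) (qI A).

Definition sim_step (v : nat -> SO) (j : nat) (st : sim) : sim :=
  let: Sim ys C s e q := st in
  let x' := drop s (take e C) in
  let y' := slice v s (e - s) in
  let ys' := ys ++ matching (shadow ys j) x' q y' in
  Sim ys' (extend j.+2 ys' C) e (size C) (observe A q (zip x' y')).1.

Fixpoint simulate v j : sim :=
  if j is j'.+1 then sim_step v j' (simulate v j') else sim0.

Record sim_ok (j : nat) (st : sim) : Prop := SimOk {
  sim_size_out : size (sim_out st) = j * d;
  sim_order : sim_start st < sim_end st < size (sim_in st);
  sim_bound : bound (sim_end st) < size (sim_in st);
  sim_block : profile A (shadow (sim_out st) j) =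
    profile A (drop (sim_start st) (take (sim_end st) (sim_in st)));
  sim_next_block : profile A (shadow (sim_out st) j.+1) =
    profile A (drop (sim_end st) (sim_in st)) }.

Lemma size_shadow ys i : size (shadow ys i) = d.
Proof. by rewrite size_map size_iota. Qed.

(** Two blocks of lookahead: answers to the first [j] blocks fix the input up to [2 * d + j * d],
    the end of block [j.+1]. *)
Lemma shadow_cat ys ys' j i :
  size ys = j * d -> i <= j.+1 -> shadow (ys ++ ys') i = shadow ys i.
Proof.
move=> sys le; apply: slice_ext => t /andP[_ lt].
have ltj : i * d <= j.+1 * d by rewrite leq_mul2r le orbT.
apply: (@X_causal (j * d)) => [l ltl|]; first by rewrite nth_cat sys ltl.
by move: ltj; rewrite mulSn; lia.
Qed.

Lemma extendP i ys C :
  [/\ size C < size (extend i ys C), bound (size C) < size (extend i ys C),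
      take (size C) (extend i ys C) = C &
      profile A (drop (size C) (extend i ys C)) = profile A (shadow ys i)].
Proof.
have [le e] := pumpP (bound (size C)).+1 (size_shadow ys i).
rewrite /extend size_cat (take_size_cat _ erefl) (drop_size_cat _ erefl).
by split; [lia | lia | | exact: e].
Qed.

Lemma sim0_ok : sim_ok 0 sim0.
Proof.
have [a1 a2 a3 a4] := extendP 0 [::] [::].
have [b1 b2 b3 b4] := extendP 1 [::] (extend 0 [::] [::]).
split; [by [] | by rewrite /= b1 andbT | exact: b2 | | by rewrite /= b4].
by rewrite /= b3 drop0 -a4 drop0.
Qed.

Lemma sim_block_size j st : sim_ok j st ->
  size (drop (sim_start st) (take (sim_end st) (sim_in st))) =
  sim_end st - sim_start st.
Proof. by move=> [_ /andP[_ lt] _ _ _]; rewrite size_drop size_takel // ltnW. Qed.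

Lemma sim_matching v j st : sim_ok j st ->
  let: Sim ys C s e q := st in
  let m := matching (shadow ys j) (drop s (take e C)) q (slice v s (e - s)) in
  size m = d /\
  observe A q (zip (shadow ys j) m) =
  observe A q (zip (drop s (take e C)) (slice v s (e - s))).
Proof.
move=> ok; have := sim_block_size ok; have := sim_block ok.
case: st ok => ys C s e q _ /= eb sb.
have [|-> ->] := matchingP q eb (y' := slice v s (e - s)).
  by rewrite sb size_map size_iota.
by rewrite size_shadow.
Qed.

Lemma sim_step_ok v j st : sim_ok j st -> sim_ok j.+1 (sim_step v j st).
Proof.
move=> ok; have := sim_matching v ok.
case: st ok => ys C s e q [/= sys /andP[lt1 lt2] bd b1 b2] [sm _].
set m := matching _ _ _ _ in sm *.
have [c1 c2 c3 c4] := extendP j.+2 (ys ++ m) C.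
split; rewrite /sim_step -/m /=.
- by rewrite size_cat sys sm mulSn addnC.
- by rewrite lt2 c1.
- exact: c2.
- by rewrite c3 (shadow_cat _ sys).
- by rewrite c4.
Qed.

Lemma simulate_ok v j : sim_ok j (simulate v j).
Proof. by elim: j => [|j]; [exact: sim0_ok | exact: sim_step_ok]. Qed.

Lemma sim_startS v j : sim_start (simulate v j.+1) = sim_end (simulate v j).
Proof. by rewrite /=; case: (simulate v j). Qed.

Lemma sim_start_lt v j : sim_start (simulate v j) < sim_start (simulate v j.+1).
Proof. by rewrite sim_startS; case/andP: (sim_order (simulate_ok v j)). Qed.

Lemma sim_out_prefix v j :
  exists u, sim_out (simulate v j.+1) = sim_out (simulate v j) ++ u.
Proof. by rewrite /=; case: (simulate v j) => *; eexists. Qed.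

Lemma sim_in_prefix v j :
  exists u, sim_in (simulate v j.+1) = sim_in (simulate v j) ++ u.
Proof. by rewrite /=; case: (simulate v j) => *; eexists. Qed.

Lemma simulate_ext v v' j :
  (forall l, l < sim_start (simulate v j) -> v l = v' l) ->
  simulate v j = simulate v' j.
Proof.
elim: j => // j IH e.
have e' l : l < sim_start (simulate v j) -> v l = v' l.
  by move=> lt; apply: e; apply: ltn_trans lt (sim_start_lt v j).
rewrite /= -(IH e'); rewrite sim_startS in e.
case: (simulate v j) e => ys C s t q /= e.
suff -> : slice v s (t - s) = slice v' s (t - s) by [].
by apply: slice_ext => l lt; apply: e; lia.
Qed.

(** Stages extend one another, so any late enough stage will do. Strictly increasing boundaries give
    stage [t] more than [t] input letters; stage [t.+1] has [t.+1 * d] outputs. *)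
Definition sim_input v t : SI := nth s0 (sim_in (simulate v t)) t.
Definition sim_output v t : SO := nth o0 (sim_out (simulate v t.+1)) t.

Lemma sim_inputE v j t : t < size (sim_in (simulate v j)) ->
  sim_input v t = nth s0 (sim_in (simulate v j)) t.
Proof.
have lt : t < size (sim_in (simulate v t)).
  have := homo_geq_id t (sim_start_lt v).
  by have /andP[] := sim_order (simulate_ok v t); lia.
rewrite /sim_input => lt'.
have [le|/ltnW le] := leqP t j.
  by rewrite (prefix_chain_nth _ (sim_in_prefix v) le).
by rewrite (prefix_chain_nth _ (sim_in_prefix v) le).
Qed.

Lemma sim_outputE v j t : t < j * d ->
  sim_output v t = nth o0 (sim_out (simulate v j)) t.
Proof.
rewrite -(sim_size_out (simulate_ok v j)) /sim_output => lt.
have lt' : t < size (sim_out (simulate v t.+1)).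
  by rewrite (sim_size_out (simulate_ok v _)) leq_pmulr.
have [le|/ltnW le] := leqP t.+1 j.
  by rewrite (prefix_chain_nth _ (sim_out_prefix v) le).
by rewrite (prefix_chain_nth _ (sim_out_prefix v) le).
Qed.

(** If position [i] lies in block [j], stage [j] reads only outputs before that block, yet holds all
    letters due until the block is answered. *)
Lemma sim_input_causal i v v' : (forall l, l < i -> v l = v' l) ->
  forall t, t < bound i.+1 -> sim_input v t = sim_input v' t.
Proof.
move=> e t lt.
have [|j /andP[le1 le2]] := @interval_index (fun j => sim_start (simulate v j)) i _
  (sim_start_lt v); first by [].
have eS : simulate v j = simulate v' j.
  by apply: simulate_ext => l ltl; apply: e; apply: leq_trans ltl le1.
have ltC : t < size (sim_in (simulate v j)).
  have := sim_bound (simulate_ok v j); apply: leq_trans; apply: (leq_trans lt).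
  by rewrite -sim_startS; apply: leqW; apply: bound_homo.
by rewrite (sim_inputE ltC) eS -sim_inputE // -eS.
Qed.

Lemma slice_outcome x (v : nat -> SO) s m :
  slice (outcome x v) s m = zip (slice x s m) (slice v s m) :> seq (SI * SO).
Proof. by rewrite /slice zip_map. Qed.

Lemma simulate_accepting x v : x =1 sim_input v ->
  accepting A (outcome x v) ->
  accepting A (outcome (X (sim_output v)) (sim_output v)).
Proof.
move=> ex; set w' := outcome x v; set w := outcome _ _.
pose p j := sim_start (simulate v j).
have long j : slice w' (p j) (p j.+1 - p j) =
    zip (drop (p j) (take (p j.+1) (sim_in (simulate v j)))) (slice v (p j) (p j.+1 - p j)).
  have /andP[lt1 lt2] := sim_order (simulate_ok v j).
  rewrite /p sim_startS slice_outcome; congr zip.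
  rewrite (@drop_take_slice _ s0); last by rewrite (ltnW lt1) (ltnW lt2).
  apply: slice_ext => t; rewrite subnKC ?(ltnW lt1) // => /andP[_ lt].
  by rewrite ex; apply: sim_inputE; apply: ltn_trans lt lt2.
have short j : slice w (j * d) d =
    zip (shadow (sim_out (simulate v j)) j) (drop (j * d) (sim_out (simulate v j.+1))).
  have s1 := sim_size_out (simulate_ok v j.+1).
  rewrite slice_outcome; congr zip.
    apply: slice_ext => t /andP[_ lt].
    by apply: (@X_causal (j * d)) => [l|]; [exact: sim_outputE | lia].
  rewrite -[sim_out _]take_size s1 (@drop_take_slice _ o0); last first.
    by rewrite s1 mulSn leq_addl leqnn.
  rewrite mulSn addnK; apply: slice_ext => t /andP[_ lt].
  by apply: sim_outputE; rewrite mulSn addnC.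
(* Observations are compared from the simulated state first; [state] then shows that both runs are
   in it at the block boundaries. *)
have blocks j : observe A (sim_state (simulate v j)) (slice w (j * d) d) =
    observe A (sim_state (simulate v j)) (slice w' (p j) (p j.+1 - p j)).
  rewrite short long /p sim_startS; have ok := simulate_ok v j.
  have := sim_matching v ok; have := sim_size_out ok.
  rewrite /=; case: (simulate v j) => ys C s e q /= sys [_ <-].
  by rewrite drop_size_cat.
have state j : run_state A w (j * d) = sim_state (simulate v j) /\
               run_state A w' (p j) = sim_state (simulate v j).
  elim: j => [//|j [e1 e2]].
  have -> : sim_state (simulate v j.+1) =
      (observe A (sim_state (simulate v j)) (slice w' (p j) (p j.+1 - p j))).1.
    by rewrite long /p sim_startS /=; case: (simulate v j).
  rewrite -{1}blocks -{1}e1 -e2 !(observe_run _ _ _ _).1 mulSn addnC.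
  by rewrite subnKC // ltnW // sim_start_lt.
apply: (@accepting_transfer _ _ A w w' d p) => //; first exact: sim_start_lt.
by move=> j; have [-> ->] := state j.
Qed.

End Simulation.

Theorem theorem1 (SI SO Q : finType) (A : PAC Q (SI * SO)%type)
  (Hcol : has_even_and_odd_color A) (f : nat -> nat) :
  let n := #|Q| in
  let k := num_colors A in
  constant_delay f ->
  f 0 = 2 ^ (2 * n ^ 4 * k ^ 2 + 1) ->
  (PlayerI_wins f (lang A) <->
   (forall f' : nat -> nat, delay_function f' -> PlayerI_wins f' (lang A))).
Proof.
move=> n k [fpos f1] f0; split=> [[tau [val win]] f' f'pos|]; last exact.
have [s0 _] : exists s0 : SI, true.
  by have := fpos 0; rewrite -(val [::]); case: (tau _) => [|s u] // _; exists s.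
(* Without output letters there is no play, so any strategy with the right block lengths wins. *)
have [/eqP/card0_eq noO|] := boolP (#|SO| == 0).
  exists (fun u => nseq (f' (size u)) s0); split=> [u|x v _ _].
    by rewrite size_nseq.
  by have := noO (v 0); rewrite inE.
rewrite -lt0n => /card_gt0P [o0 _].
have [X cX consX] := strategyI_causal fpos s0 val.
pose d := 2 ^ (2 * n ^ 4 * k ^ 2).
have d_gt0 : 0 < d by rewrite expn_gt0.
(* The [+ 1] in the exponent of [f 0] provides the two blocks of lookahead. *)
have startE i : block_start f i.+1 = 2 * d + i.
  elim: i => [|i IH]; last by rewrite block_startS IH f1 // addn1 addnS.
  by rewrite block_startS /block_start big_ord0 f0 addn1 expnS addn0.
have X_causal i y y' : (forall l, l < i -> y l = y' l) ->
    forall t, t < 2 * d + i -> X y t = X y' t.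
  by move=> e t; rewrite -startE; apply: cX.
have bound_homo : {homo block_start f' : i j / i <= j} by exact: block_start_homo.
have card := card_profile Hcol.
apply: (@causal_PlayerI_wins _ _ f' f'pos o0
  (sim_input A s0 o0 X d (block_start f'))) => [i v v'|x v ex acc].
  exact: (sim_input_causal A s0 o0 d_gt0 card X_causal bound_homo).
apply: (win _ _ (consX (sim_output A o0 X d (block_start f') v))).
exact: (simulate_accepting d_gt0 card X_causal ex acc).
Qed.
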